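(* Let $\Gamma>0$, let $\lambda_-^*\le\lambda_+^*$ be real numbers and $q\in M_1([\lambda_-^*,\lambda_+^*])$. Then: the function $m\mapsto I^H_q(m;\lambda^*_\pm,\Gamma)$ is continuous on $(m_-^*,m_+^* )$, non-increasing on $(m_-^*,\overline m]$ and convex strictly increasing on $[\overline m,m_+^* )$; the function $m\mapsto I^G_q(m;\lambda^*_\pm,\Gamma)$ is continuous on $(\frac12\lambda_+^*,\infty)$, non-increasing on $(\frac12\lambda_+^*,\overline m]$ and convex strictly increasing on $[\overline m,\infty)$.
   Context: For $J\subseteq\mathbb R$, $M_+(J)$ is the space of finite Borel measures on $J$ and $M_1(J)$ the subspace of probability measures. For $\xi\in\mathbb R$ and $\nu\in M_+((-\infty,\xi])$, $$F(\xi,\nu;\Gamma)=\frac12\inf_{\theta>\xi}\Big[\theta+\Gamma\int\frac{\nu(dx)}{\theta-x}\Big].$$ For a probability measure $\mu$ and a finite measure $\nu$, $H(\mu|\nu)=\int d\mu\,\log\big(\frac{d\mu}{d\nu}\big)+\nu(\mathbb R)-1$ if $\mu\ll\nu$, and $\infty$ otherwise. Define $$I^H_q(m;\lambda^*_\pm,\Gamma)=\inf\{\tfrac12H(q|\nu):\nu\in M_1([\lambda_-^*,\lambda_+^*]),\ m=F(\lambda_+^*,\nu;\Gamma)\},$$ $$I^G_q(m;\lambda^*_\pm,\Gamma)=\inf\{\tfrac12H(q|\nu):\nu\in M_+([\lambda_-^*,\lambda_+^*]),\ m=F(\lambda_+^*,\nu;\Gamma)\},$$ with the infimum over the empty set equal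 to $+\infty$. Further $$\overline m=F(\lambda_+^*,q;\Gamma),\qquad m_-^*=F(\lambda_+^*,\delta_{\lambda_-^*};\Gamma)=\tfrac12\Big(\theta_-^*+\frac{\Gamma}{\theta_-^*-\lambda_-^*}\Big),\quad \theta_-^*=\max\{\lambda_+^*,\lambda_-^*+\sqrt\Gamma\},$$ $$m_+^*=F(\lambda_+^*,\delta_{\lambda_+^*};\Gamma)=\tfrac12\lambda_+^*+\sqrt\Gamma .$$ *)

(* Defs.v *)
From HB Require Import structures.
From mathcomp Require Import all_boot all_order all_algebra.
From mathcomp Require Import all_classical all_reals all_analysis.
Import Order.TTheory GRing.Theory Num.Theory.
Import numFieldNormedType.Exports.

Set Implicit Arguments.
Unset Strict Implicit.
Unset Printing Implicit Defensive.

Local Open Scope classical_set_scope.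
Local Open Scope ring_scope.
Local Open Scope charge_scope.

(* An element of M_+(J) (resp. M_1(J)) is represented by a finite Borel measure
   (resp. a probability measure) on the whole line that does not charge the
   complement of J. *)
Definition supported_on (R : realType) (J : set R)
    (nu : {measure set (measurableTypeR R) -> \bar R}) : Prop :=
  nu (~` J) = 0%E.

(* Meaningful for 0 <= Gamma: the set of which the infimum is taken is then
   nonempty and bounded below by xi. *)
Definition F (R : realType) (xi : R)
    (nu : {finite_measure set (measurableTypeR R) -> \bar R}) (Gamma : R) : R :=
  2^-1 * inf [set theta + Gamma * \int[nu]_(x in `]-oo, xi]) (theta - x)^-1
             | theta in `]xi, +oo[].

(* The set {d mu / d nu = 0}, where [lne] is -oo, is mu-negligible. *)
Definition H (R : realType) (mu : probability (measurableTypeR R) R)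
    (nu : {finite_measure set (measurableTypeR R) -> \bar R}) : \bar R :=
  if `[< mu `<< nu >] then
    (\int[mu]_x lne (('d (charge_of_finite_measure mu) '/d nu) x)
     + nu setT - 1)%E
  else +oo%E.

Definition I_H (R : realType) (q : probability (measurableTypeR R) R)
    (lm lp Gamma m : R) : \bar R :=
  ereal_inf [set ((2^-1)%:E * H q nu)%E | nu in
    [set nu : probability (measurableTypeR R) R |
      supported_on `[lm, lp] nu /\ m = F lp nu Gamma]].

Definition I_G (R : realType) (q : probability (measurableTypeR R) R)
    (lm lp Gamma m : R) : \bar R :=
  ereal_inf [set ((2^-1)%:E * H q nu)%E | nu in
    [set nu : {finite_measure set (measurableTypeR R) -> \bar R} |
      supported_on `[lm, lp] nu /\ m = F lp nu Gamma]].

Definition m_bar (R : realType) (q : probability (measurableTypeR R) R)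
    (lp Gamma : R) : R :=
  F lp q Gamma.

Definition m_minus (R : realType) (lm lp Gamma : R) : R :=
  F lp (dirac (lm : measurableTypeR R)) Gamma.

Definition m_plus (R : realType) (lp Gamma : R) : R :=
  F lp (dirac (lp : measurableTypeR R)) Gamma.

Definition nonincreasing_on (R : realType) (A : set R) (f : R -> \bar R) : Prop :=
  forall x y, A x -> A y -> x <= y -> (f y <= f x)%E.

Definition strictly_increasing_on (R : realType) (A : set R)
    (f : R -> \bar R) : Prop :=
  forall x y, A x -> A y -> x < y -> (f x < f y)%E.

(* [convex_function] of the library is restricted to real-valued functions. *)
Definition convex_on (R : realType) (A : set R) (f : R -> \bar R) : Prop :=
  forall t x y, 0 <= t <= 1 -> A x -> A y ->
    (f (t * x + (1 - t) * y)%R <= t%:E * f x + (1 - t)%:E * f y)%E.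

(* Main.v *)
Require Import Defs.
From HB Require Import structures.
From mathcomp Require Import all_boot all_order all_algebra.
From mathcomp Require Import all_classical all_reals all_analysis.
From mathcomp Require Import measurable_realfun ring lra.
Import Order.TTheory GRing.Theory Num.Theory.
Import numFieldNormedType.Exports.

(** Both functions are instances of one construction.  Let [C] be a convex class
    of finite measures containing [q] and a measure [kappa], and let [rate m] be
    the infimum of [H(q|nu) / 2] over the [nu] in [C] with [F nu = m].  For
    [I_H], [C] consists of the probability measures on [[lm, lp]] and [kappa] is
    the Dirac mass at [lm]; for [I_G], [C] consists of all the finite measures
    on [[lm, lp]] and [kappa = 0].  In both cases [kappa] has the smallest
    Stieltjes transform in [C].

    Entropy.  The Gibbs inequality [gibbs] bounds the integral of [log f] against
    [q] by [H(q|nu)] plus the integral of [f - 1] against [nu], for every [f >= 0];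
    it is an equality when [f] is the density of [q] with respect to [nu]
    ([H_density]).  Nonnegativity, convexity of [nu |-> H(q|nu)] and the cost of
    adding a multiple of another measure ([H_lincomb_le]) all follow by choosing
    [f].

    Monotonicity.  [F] is an infimum of functions that are affine in [nu]; hence
    it is concave, and along a segment it takes all the values between those at
    the end points ([F_between]).  Moving from [nu] towards [q] does not increase
    the entropy because [H(q|q) = 0], so every level between [F q] and [F nu] is
    reached at a cost of at most [H(q|nu)] ([rate_mix_le]): the rate is
    nonincreasing before [F q] and nondecreasing after it.  After [F q] it is
    convex, since a mixture of two measures has a value of [F] at least equal to
    the mixed level.  It vanishes at [F q] and is positive beyond ([rate_gt0]): if
    [H(q|nu)] is small, the Stieltjes transform of [nu] at a fixed point [theta]
    exceeds that of [q] by little, and so [F nu] exceeds [F q] by little.  With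
    convexity this gives strict growth.

    Continuity.  After [F q] it follows from convexity.  Before [F q], where
    convexity is not available, mix a near-minimiser [nu] with a small proportion
    [s] of [kappa]: the entropy grows by [O(s)], while [F] decreases by at least
    [c * s] with [c > 0] independent of [nu] ([F_decrease]).  So the rate is
    locally Lipschitz ([rate_left_lip]). *)

Set Implicit Arguments.
Unset Strict Implicit.
Unset Printing Implicit Defensive.

Local Open Scope classical_set_scope.
Local Open Scope ring_scope.

(** * Linear combinations of finite measures *)

(** The measure [a mu + b nu]; the coefficients are meant to be nonnegative, and
    absolute values make the definition total. *)
Definition lincomb d (T : measurableType d) (R : realType) (a b : R)
    (mu nu : {finite_measure set T -> \bar R}) :=
  measure_add (mscale `|a|%:nng mu) (mscale `|b|%:nng nu).

HB.instance Definition _ d (T : measurableType d) (R : realType) (a b : R)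
    (mu nu : {finite_measure set T -> \bar R}) :=
  Measure.on (lincomb a b mu nu).

Lemma lincomb_fin_num d (T : measurableType d) (R : realType) (a b : R)
    (mu nu : {finite_measure set T -> \bar R}) :
  fin_num_fun (lincomb a b mu nu).
Proof.
move=> A mA; rewrite /lincomb measure_addE fin_numD.
by rewrite !fin_num_measure.
Qed.

HB.instance Definition _ d (T : measurableType d) (R : realType) (a b : R)
    (mu nu : {finite_measure set T -> \bar R}) :=
  Measure_isFinite.Build _ _ _ (lincomb a b mu nu) (lincomb_fin_num a b mu nu).

Section lincomb_lemmas.
Context d (T : measurableType d) (R : realType).
Implicit Types mu nu : {finite_measure set T -> \bar R}.

Lemma lincombE (a b : R) mu nu A : 0 <= a -> 0 <= b ->
  lincomb a b mu nu A = (a%:E * mu A + b%:E * nu A)%E.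
Proof.
by move=> a0 b0; rewrite /lincomb measure_addE /= /mscale /= ger0_norm// ger0_norm.
Qed.

Lemma ge0_integral_lincomb (a b : R) mu nu (D : set T)
    (f : T -> \bar R) : 0 <= a -> 0 <= b ->
  measurable D -> (forall x, D x -> 0 <= f x)%E -> measurable_fun D f ->
  (\int[lincomb a b mu nu]_(x in D) f x =
   a%:E * \int[mu]_(x in D) f x + b%:E * \int[nu]_(x in D) f x)%E.
Proof.
move=> a0 b0 mD f0 mf.
rewrite ge0_integral_measure_add// !ge0_integral_mscale//=.
by rewrite ger0_norm// ger0_norm.
Qed.

(** The total mass of a finite measure, as a real number. *)
Definition mass (mu : {finite_measure set T -> \bar R}) : R :=
  fine (mu setT).

Lemma massE mu : mu setT = (mass mu)%:E.
Proof. by rewrite /mass fineK// fin_num_measure. Qed.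

Lemma mass_ge0 mu : 0 <= mass mu.
Proof. exact: fine_ge0. Qed.

Lemma mass_lincomb (a b : R) mu nu : 0 <= a -> 0 <= b ->
  mass (lincomb a b mu nu) = a * mass mu + b * mass nu.
Proof.
by move=> a0 b0; rewrite {1}/mass /= lincombE// !massE -!EFinM -EFinD.
Qed.

Lemma dominates_lincombl (q : {measure set T -> \bar R}) (a b : R) mu nu :
  0 < a -> 0 <= b -> q `<< mu -> q `<< lincomb a b mu nu.
Proof.
move=> a0 b0 qmu; have a0W := ltW a0; apply: null_dominates_trans qmu _.
apply/null_content_dominatesP => A mA /=; rewrite lincombE// => /eqP.
rewrite padde_eq0; [|by rewrite mule_ge0..].
by rewrite mule_eq0 eqe gt_eqF//= => /andP[/eqP].
Qed.

End lincomb_lemmas.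

(** * Relative entropy *)

Lemma measurable_lne (R : realType) d (T : measurableType d) (h : T -> R) :
  measurable_fun setT h -> measurable_fun setT (fun x => lne (h x)%:E).
Proof.
move=> mh; rewrite /lne; apply: measurable_fun_ifT => //=.
- exact: measurable_fun_ler.
- by apply/measurable_EFinP; exact: measurableT_comp.
Qed.

Section entropy.
Context (R : realType) (q : probability (measurableTypeR R) R).
Implicit Types nu : {finite_measure set (measurableTypeR R) -> \bar R}.

(** A version of the density of [q] that is real-valued and nonnegative
    everywhere, with the change of variables that it provides. *)
Lemma dominates_density nu : q `<< nu ->
  exists h : measurableTypeR R -> R,
  [/\ measurable_fun setT h, (forall x, 0 <= h x),
      q [set x | h x = 0] = 0%E,
      (forall f : measurableTypeR R -> R, measurable_fun setT f ->
         (forall x, (0 <= f x)%R) ->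
         \int[q]_x (f x)%:E = \int[nu]_x (f x * h x)%:E)%E &
      H q nu = (\int[q]_x lne (h x)%:E + (mass nu - 1)%:E)%E ].
Proof.
move=> qnu.
pose g := Radon_Nikodym_SigmaFinite.f q nu.
have gfin x : g x \is a fin_num by exact: Radon_Nikodym_SigmaFinite.f_fin_num.
have g0 x : (0 <= g x)%E by exact: Radon_Nikodym_SigmaFinite.f_ge0.
have ig : nu.-integrable setT g by exact: Radon_Nikodym_SigmaFinite.f_integrable.
have mg : measurable_fun setT g := measurable_int _ ig.
have mh : measurable_fun setT (fine \o g) by exact: measurableT_comp.
have gE x : g x = (fine (g x))%:E by rewrite fineK.
exists (fine \o g); split => //.
- by move=> x; exact: fine_ge0.
- rewrite (Radon_Nikodym_SigmaFinite.f_integral qnu); last first.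
    rewrite [X in measurable X](_ : _ = setT `&` (fine \o g) @^-1` [set 0]).
      exact: mh.
    by rewrite setTI; apply/seteqP; split.
  by apply: integral0_eq => x /= gx; rewrite -/g gE gx.
- move=> f mf f0.
  rewrite -(@Radon_Nikodym_SigmaFinite.change_of_variables _ _ _ q nu qnu
              (EFin \o f) setT)//.
  + by apply: eq_integral => x _ /=; rewrite EFinM -gE.
  + exact/measurable_EFinP.
- rewrite /H asboolT// massE -addeA EFinB; congr (_ + _)%E.
  apply: ae_eq_integral => //.
  + pose k := Radon_Nikodym (charge_of_finite_measure q) nu.
    rewrite (_ : (fun x => _) = fun x => lne (fine (k x))%:E).
      apply: measurable_lne; apply: measurableT_comp => //.
      exact: measurable_int (Radon_Nikodym_integrable _).
    by apply/funext => x; rewrite fineK//; exact: Radon_Nikodym_fin_num.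
  + exact: measurable_lne.
  + apply: (null_dominates_ae_eq _ qnu) => //.
    have := ae_eq_Radon_Nikodym_SigmaFinite qnu measurableT.
    by move=> /ae_eq_sym; apply: filterS => x /= xE _; rewrite xE// -/g {1}gE.
Qed.

End entropy.

Section integral_complements.
Context d (T : measurableType d) (R : realType).
Variable mu : {measure set T -> \bar R}.
Local Open Scope ereal_scope.

(** No integrability is needed: when both parts of the integral are infinite,
    its value is [-oo] by convention. *)
Lemma le_integral_measurable (f g : T -> \bar R) :
  measurable_fun setT f -> measurable_fun setT g -> (forall x, f x <= g x) ->
  \int[mu]_x f x <= \int[mu]_x g x.
Proof.
move=> mf mg fg; rewrite (integralE _ _ f) (integralE _ _ g).
have fgD : {in [set: T], forall x, f x <= g x} by [].
apply: leeB; apply: ge0_le_integral => //.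
- exact: measurable_funepos.
- exact: measurable_funepos.
- by move=> x _; apply: (funepos_le fgD); rewrite inE.
- exact: measurable_funeneg.
- exact: measurable_funeneg.
- by move=> x _; apply: (funeneg_le fgD); rewrite inE.
Qed.

Lemma integrable_of_lty (f : T -> \bar R) : measurable_fun setT f ->
  \int[mu]_x f^\- x < +oo -> \int[mu]_x f x < +oo -> mu.-integrable setT f.
Proof.
move=> mf fn fi; apply/integrableP; split => //.
have mp := measurable_funepos mf; have mn := measurable_funeneg mf.
rewrite -[fun x => _]/(abse \o f) fune_abse.
rewrite ge0_integralD//; apply: lte_add_pinfty => //.
have fn0 : 0 <= \int[mu]_x f^\- x by exact: integral_ge0.
move: fi; rewrite integralE.
case: (\int[mu]_x f^\+ x) => [r _| |_]; [exact: ltry| |exact: ltNye].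
by move: fn fn0; case: (\int[mu]_x f^\- x).
Qed.

End integral_complements.

Section gibbs.
Context (R : realType) (q : probability (measurableTypeR R) R).
Implicit Types nu : {finite_measure set (measurableTypeR R) -> \bar R}.

Lemma H_lty_dominates nu (a : R) : (H q nu <= a%:E)%E -> q `<< nu.
Proof. by rewrite /H; case: asboolP. Qed.

Lemma lne_le_ln (x y : R) : 0 <= x -> 0 < y ->
  (lne x%:E <= (ln y + (x / y - 1))%:E)%E.
Proof.
rewrite le_eqVlt => /orP[/eqP <- y0|x0 y0].
  by rewrite /= lexx leNye.
rewrite lne_EFin// lee_fin -lerBlDl -ln_div// -[x in ln x](subrK 1) addrC.
by apply: le_ln1Dx; rewrite ltrBrDl subrr divr_gt0.
Qed.

(** The Gibbs inequality for [c * f], with [ln c] moved to the right-hand side.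
    With [h] the density of [q], it integrates the pointwise bound
    [ln (c * f) <= ln h + c * f / h - 1]. *)
Lemma gibbs nu (a b c : R) (f : measurableTypeR R -> R) : 0 < c ->
  measurable_fun setT f -> (forall x, 0 <= f x) ->
  (H q nu <= a%:E)%E -> (\int[nu]_x (f x)%:E <= b%:E)%E ->
  (\int[q]_x lne (f x)%:E <= (a - ln c + c * b - mass nu)%:E)%E.
Proof.
move=> c0 mf f0 Ha fb.
have qnu := H_lty_dominates Ha.
have [h [mh h0 qh0 chv HE]] := dominates_density qnu.
(* [h] vanishes only on a [q]-null set; [h1] is a positive version of it. *)
pose h1 x := if h x == 0 then 1 else h x.
have h1_gt0 x : 0 < h1 x.
  by rewrite /h1; case: eqVneq => // hx; rewrite lt_neqAle eq_sym hx h0.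
have mh0 : measurable [set x | h x = 0].
  rewrite [X in measurable X](_ : _ = setT `&` h @^-1` [set 0]); first exact: mh.
  by rewrite setTI; apply/seteqP; split.
have mh1 : measurable_fun setT h1.
  apply: measurable_fun_ifT => //=.
  apply: (measurable_fun_bool true).
  rewrite [X in measurable X](_ : _ = [set x | h x = 0])//.
  by rewrite setTI; apply/seteqP; split => x /= /eqP.
have mV : measurable_fun setT (fun x => (h1 x)^-1).
  rewrite (_ : (fun x => _) = fun x => expR (- ln (h1 x))).
    apply: measurableT_comp => //; apply: measurableT_comp => //.
    exact: measurableT_comp.
  by apply/funext => x; rewrite -lnV ?posrE// lnK// posrE invr_gt0.
(* Dividing by [h1] turns integrals against [q] into integrals against [nu],
   up to the part of [nu] that is singular with respect to [q]. *)
have chv1 (g : measurableTypeR R -> R) (e : R) :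
    measurable_fun setT g -> (forall x, 0 <= g x) ->
    (\int[nu]_x (g x)%:E <= e%:E)%E ->
    (\int[q]_x (g x / h1 x)%:E <= e%:E)%E.
  move=> mg g0 gc; rewrite chv//; last 2 first.
    exact: measurable_funM.
    by move=> x; rewrite divr_ge0// ltW.
  apply: le_trans gc; apply: ge0_le_integral => //=.
  - by move=> x _; rewrite lee_fin mulr_ge0// divr_ge0// ltW.
  - apply/measurable_EFinP; apply: measurable_funM => //.
    exact: measurable_funM.
  - exact/measurable_EFinP.
  - move=> x _; rewrite lee_fin /h1; case: eqVneq => [->|hx].
      by rewrite mulr0.
    by rewrite divfK.
have iw (g : measurableTypeR R -> R) (e : R) :
    measurable_fun setT g -> (forall x, 0 <= g x) ->
    (\int[nu]_x (g x)%:E <= e%:E)%E ->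
    q.-integrable setT (fun x => (g x / h1 x)%:E).
  move=> mg g0 gc; apply/integrableP; split.
    by apply/measurable_EFinP; exact: measurable_funM.
  apply: le_lt_trans (ltry e); rewrite (le_trans _ (chv1 _ _ mg g0 gc))//.
  rewrite le_eqVlt; apply/orP; left; apply/eqP; apply: eq_integral => x _.
  by rewrite gee0_abs// lee_fin divr_ge0// ltW.
have mu_ : measurable_fun setT (fun x => (ln (h1 x))%:E).
  by apply/measurable_EFinP; exact: measurableT_comp.
have intu : (\int[q]_x (ln (h1 x))%:E <= (a - mass nu + 1)%:E)%E.
  have -> : (\int[q]_x (ln (h1 x))%:E = \int[q]_x lne (h x)%:E)%E.
    apply: ae_eq_integral => //; first exact: measurable_lne.
    exists [set x | h x = 0]; split => //.
    move=> x /= /not_implyP[_]; apply: contra_notP => /eqP hx.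
    by rewrite /h1 (negbTE hx) leNgt lt_neqAle eq_sym hx h0.
  move: Ha; rewrite HE; case: (\int[q]_x _)%E => [r| |]//=.
    by rewrite -EFinD !lee_fin; lra.
  by move=> _; rewrite leNye.
(* The negative part of [ln h1] is at most [1 / h1], which is integrable. *)
have iu : q.-integrable setT (fun x => (ln (h1 x))%:E).
  apply: integrable_of_lty => //; last exact: le_lt_trans intu (ltry _).
  apply: (@le_lt_trans _ _ (\int[q]_x (1 / h1 x)%:E)%E).
    apply: ge0_le_integral => //=.
    - exact: measurable_funeneg.
    - by apply/measurable_EFinP; exact: measurable_funM.
    move=> x _; rewrite funenegE -EFinN -EFin_max lee_fin ge_max.
    apply/andP; split; last by rewrite divr_ge0// ltW.
    rewrite -lnV ?posrE// div1r.
    rewrite -{1}[_^-1](subrK 1) addrC.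
    apply: (le_trans (le_ln1Dx _)); last by rewrite lerBlDr lerDl.
    by rewrite ltrBrDl subrr invr_gt0.
  apply: (@le_lt_trans _ _ (mass nu)%:E); last exact: ltry.
  apply: (chv1 (cst 1)) => //.
  by rewrite (integral_cst _ measurableT 1%E) mul1e -massE.
have mcf : measurable_fun setT (fun x => c * f x) by exact: measurable_funM.
have cf0 x : 0 <= c * f x by rewrite mulr_ge0// ltW.
have cfb : (\int[nu]_x (c * f x)%:E <= (c * b)%:E)%E.
  under eq_integral do rewrite EFinM.
  rewrite ge0_integralZl//.
  - by rewrite EFinM lee_wpmul2l// lee_fin ltW.
  - exact/measurable_EFinP.
  - by move=> x _; rewrite lee_fin.
  - by rewrite lee_fin ltW.
have iw1 := iw _ _ mcf cf0 cfb.
have ik : q.-integrable setT (cst (ln c + 1)%:E).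
  exact: finite_measure_integrable_cst.
have iw2 : q.-integrable setT (fun x => (c * f x / h1 x)%:E - (ln c + 1)%:E)%E.
  exact: integrableB.
apply: (@le_trans _ _
    (\int[q]_x ((ln (h1 x))%:E + ((c * f x / h1 x)%:E - (ln c + 1)%:E)))%E).
  apply: le_integral_measurable => //.
  - exact: measurable_lne.
  - by apply: emeasurable_funD => //; exact: measurable_int iw2.
  move=> x; have h1c : 0 < h1 x / c by rewrite divr_gt0.
  apply: le_trans (lne_le_ln (f0 x) h1c) _.
  rewrite -EFinN -!EFinD lee_fin ln_div ?posrE//.
  rewrite (_ : f x / (h1 x / c) = c * f x / h1 x); last by field; rewrite !gt_eqF.
  by rewrite le_eqVlt; apply/orP; left; apply/eqP; ring.
rewrite integralD// integralB//.
rewrite (integral_cst _ measurableT (ln c + 1)%:E).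
rewrite [X in (_ * X)%E]probability_setT mule1.
have := chv1 _ _ mcf cf0 cfb; move: intu.
have := integrable_fin_num measurableT iu.
have := integrable_fin_num measurableT iw1.
case: (\int[q]_x (c * f x / h1 x)%:E)%E => // r _.
case: (\int[q]_x (ln (h1 x))%:E)%E => // s _.
by rewrite -!EFinD !lee_fin; lra.
Qed.

End gibbs.

Section entropy_bounds.
Context (R : realType) (q : probability (measurableTypeR R) R).
Implicit Types nu : {finite_measure set (measurableTypeR R) -> \bar R}.

Lemma mass_probability : mass q = 1.
Proof. by rewrite /mass /= probability_setT. Qed.

(** The density of [q] is a case of equality in [gibbs]. *)
Lemma H_density nu : q `<< nu ->
  exists h : measurableTypeR R -> R,
  [/\ measurable_fun setT h, (forall x, 0 <= h x),
      (\int[nu]_x (h x)%:E = 1)%E &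
      H q nu = (\int[q]_x lne (h x)%:E + (mass nu - 1)%:E)%E ].
Proof.
move=> /dominates_density[h [mh h0 _ chv HE]]; exists h; split => //.
have := chv (cst 1) (measurable_cst _) (fun=> ler01).
rewrite (integral_cst _ measurableT 1%E) mul1e [X in X = _]probability_setT => ->.
by apply: eq_integral => x _; rewrite mul1r.
Qed.

Lemma H_self_le0 : (H q q <= 0)%E.
Proof.
have qq : q `<< q by [].
have [h [mh h0 h1 ->]] := H_density qq.
rewrite mass_probability subrr adde0.
apply: (@le_trans _ _ (\int[q]_x ((h x)%:E - 1))%E).
  apply: le_integral_measurable => //; first exact: measurable_lne.
    by apply: emeasurable_funB => //; exact/measurable_EFinP.
  move=> x; apply: le_trans (lne_le_ln (h0 x) ltr01) _.
  by rewrite ln1 add0r divr1.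
have ih : q.-integrable setT (EFin \o h).
  apply/integrableP; split; first exact/measurable_EFinP.
  under eq_integral => x _ do rewrite gee0_abs ?lee_fin//.
  by rewrite h1 ltry.
rewrite integralB//; last exact: finite_measure_integrable_cst.
rewrite h1 (integral_cst _ measurableT 1%E) mul1e.
by rewrite [X in (_ - X)%E]probability_setT subee.
Qed.

Lemma H_ge0 nu : (0 <= H q nu)%E.
Proof.
have H_ge (a : R) : (H q nu <= a%:E)%E -> 0 <= a.
  move=> Ha; have := @gibbs _ _ _ a (mass nu) 1 (cst 1) ltr01 _ _ Ha.
  rewrite ln1 (integral_cst _ measurableT 1%E) mul1e -massE lexx /=.
  rewrite ler10 integral_cst// ln1 mul0e.
  by move=> /(_ (measurable_cst _) (fun=> ler01) isT); rewrite lee_fin; lra.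
case E : (H q nu) => [r| |]; first by rewrite lee_fin H_ge ?E.
  exact: leey.
by have := H_ge (-1); rewrite E leNye => /(_ isT); rewrite ler0N1.
Qed.

(** Convexity in the second argument: the convex combination of the Gibbs
    inequalities for [nu1] and [nu2], applied to the density of [q] with respect
    to the mixture. *)
Lemma H_convex nu1 nu2 (a b s : R) : 0 < s < 1 ->
  (H q nu1 <= a%:E)%E -> (H q nu2 <= b%:E)%E ->
  (H q (lincomb (1 - s) s nu1 nu2) <= ((1 - s) * a + s * b)%:E)%E.
Proof.
move=> /andP[s0 s1] Ha Hb.
have s'0 : 0 < 1 - s by rewrite subr_gt0.
have s0W := ltW s0; have s'0W := ltW s'0.
set nu := lincomb _ _ _ _.
have qnu : q `<< nu by apply: dominates_lincombl => //; exact: H_lty_dominates Ha.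
have [h [mh h0 h1 ->]] := H_density qnu.
have mEh : measurable_fun setT (EFin \o h) by exact/measurable_EFinP.
move: h1; rewrite ge0_integral_lincomb//; last by move=> x _; rewrite lee_fin.
have i1 : (0 <= \int[nu1]_x (h x)%:E)%E by apply: integral_ge0 => x _; rewrite lee_fin.
have i2 : (0 <= \int[nu2]_x (h x)%:E)%E by apply: integral_ge0 => x _; rewrite lee_fin.
have g1 := @gibbs _ _ _ a _ 1 h ltr01 mh h0 Ha.
have g2 := @gibbs _ _ _ b _ 1 h ltr01 mh h0 Hb.
rewrite mass_lincomb//.
move: i1 i2 g1 g2; rewrite ln1.
case: (\int[nu1]_x (h x)%:E)%E => [u1 _|_|//]; last first.
  move=> i2 _ _; rewrite gt0_muley ?lte_fin// addye//.
  by rewrite gt_eqF// (lt_le_trans (ltNyr 0))// mule_ge0// lee_fin ltW.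
case: (\int[nu2]_x (h x)%:E)%E => [u2 _|_|//]; last first.
  by move=> _ _; rewrite gt0_muley ?lte_fin// addey.
move=> /(_ u1 (lexx _)) + /(_ u2 (lexx _)).
case: (\int[q]_x _)%E => [r| |]//; rewrite -?EFinM -?EFinD ?lee_fin.
  by move=> g1 g2 [] E; nra.
by move=> *; exact: leNye.
Qed.

(** Replacing [nu1] by [c nu1 + e nu2] raises the entropy by at most [- ln c] plus
    the variation of the mass, whatever [nu2] is: this is [gibbs] for [nu1] and
    the density of [q] with respect to the combination. *)
Lemma H_lincomb_le nu1 nu2 (a c e : R) : 0 < c -> 0 <= e ->
  (H q nu1 <= a%:E)%E ->
  (H q (lincomb c e nu1 nu2) <=
     (a - ln c + (mass (lincomb c e nu1 nu2) - mass nu1))%:E)%E.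
Proof.
move=> c0 e0 Ha; have c0W := ltW c0; set nu := lincomb _ _ _ _.
have qnu : q `<< nu by apply: dominates_lincombl => //; exact: H_lty_dominates Ha.
have [h [mh h0 h1 ->]] := H_density qnu.
have mEh : measurable_fun setT (EFin \o h) by exact/measurable_EFinP.
move: h1; rewrite ge0_integral_lincomb//; last by move=> x _; rewrite lee_fin.
have i1 : (0 <= \int[nu1]_x (h x)%:E)%E by apply: integral_ge0 => x _; rewrite lee_fin.
have i2 : (0 <= e%:E * \int[nu2]_x (h x)%:E)%E.
  by rewrite mule_ge0 ?lee_fin//; apply: integral_ge0 => x _; rewrite lee_fin.
have g1 := @gibbs _ _ _ a _ c h c0 mh h0 Ha.
move: i1 i2 g1.
case: (\int[nu1]_x (h x)%:E)%E => [u1 _|_|//]; last first.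
  move=> i2 _; rewrite gt0_muley ?lte_fin// addye//.
  by rewrite gt_eqF// (lt_le_trans (ltNyr 0)).
case: (e%:E * _)%E => [u2 u20|_ _|//]; last by rewrite -EFinM addey.
move=> /(_ u1 (lexx _)).
case: (\int[q]_x _)%E => [r| |]//; rewrite -?EFinM -?EFinD ?lee_fin.
  by move: u20; rewrite lee_fin => u20 g1 [] E; lra.
by move=> *; exact: leNye.
Qed.

Lemma ln1B_ge (u : R) : 0 <= u <= 2^-1 -> - u - 2 * u ^+ 2 <= ln (1 - u).
Proof.
move=> /andP[u0 u1].
have v0 : 0 < 1 - u by lra.
suff : - ln (1 - u) <= u + 2 * u ^+ 2 by lra.
rewrite -lnV ?posrE// -[_^-1](subrK 1) addrC.
have w0 : (1 - u)^-1 - 1 = u / (1 - u) by field; lra.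
apply: le_trans (le_ln1Dx _) _.
  by rewrite ltrBrDl subrr invr_gt0.
by rewrite w0 ler_pdivrMr//; nra.
Qed.

(** If [H(q|nu)] is small, the integral of a bounded function against [nu] is not
    much larger than its integral against [q].  This is [gibbs] for [1 - e * f]. *)
Lemma integral_le_H nu (a e M : R) (f : measurableTypeR R -> R) :
  measurable_fun setT f -> (forall x, 0 <= f x <= M) ->
  0 < e -> e * M <= 2^-1 -> (H q nu <= a%:E)%E ->
  \int[nu]_x f x <= \int[q]_x f x + a / e + 2 * e * M ^+ 2.
Proof.
move=> mf f0M e0 eM Ha.
have M0 : 0 <= M by have /andP[] := f0M point; exact: le_trans.
have ib (m : {finite_measure set (measurableTypeR R) -> \bar R}) :
    m.-integrable setT (EFin \o f).
  apply: (@le_integrable _ _ _ m _ measurableT _ (cst M%:E)).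
  - exact/measurable_EFinP.
  - move=> x _ /=; have /andP[f0 fM] := f0M x.
    by rewrite lee_fin !ger0_norm.
  - exact: finite_measure_integrable_cst.
have iE (m : {finite_measure set (measurableTypeR R) -> \bar R}) :
    (\int[m]_x (f x)%:E = (\int[m]_x f x)%:E)%E.
  by rewrite /Rintegral fineK//; exact: (integrable_fin_num measurableT (ib m)).
have f1 x : 0 <= 1 - e * f x by have /andP[] := f0M x; nra.
have mf1 : measurable_fun setT (fun x => 1 - e * f x).
  by apply: measurable_funB => //; exact: measurable_funM.
have ief (m : {finite_measure set (measurableTypeR R) -> \bar R}) :
    m.-integrable setT (fun x => e%:E * (f x)%:E)%E.
  by exact: (integrableZl measurableT e (ib m)).
have := @gibbs _ _ _ a (mass nu - e * \int[nu]_x f x) 1 _ ltr01 mf1 f1 Ha.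
have -> : (\int[nu]_x (1 - e * f x)%:E = (mass nu - e * \int[nu]_x f x)%:E)%E.
  under eq_integral do rewrite EFinB EFinM.
  rewrite integralB//; [|exact: finite_measure_integrable_cst|exact: ief].
  rewrite (integral_cst _ measurableT 1%E) mul1e (integralZl measurableT (ib nu)) /= iE.
  by rewrite [RHS]EFinB EFinM massE.
move=> /(_ (lexx _)); rewrite ln1 => g.
have {g} : (\int[q]_x ((- (2 * e ^+ 2 * M ^+ 2))%:E - e%:E * (f x)%:E) <=
    (a - 0 + 1 * (mass nu - e * \int[nu]_x f x) - mass nu)%:E)%E.
  apply: le_trans g; apply: le_integral_measurable.
  - apply: emeasurable_funB => //.
    exact: (measurable_int _ (ief q)).
  - exact: measurable_lne.
  move=> x; have /andP[f0 fM] := f0M x.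
  have efM : e * f x <= e * M by rewrite ler_wpM2l// ltW.
  have ef0 : 0 <= e * f x by rewrite mulr_ge0// ltW.
  rewrite lne_EFin; last by lra.
  rewrite -EFinM -EFinB lee_fin; apply: le_trans (ln1B_ge _); last by lra.
  have : (e * f x) ^+ 2 <= (e * M) ^+ 2 by rewrite lerXn2r// nnegrE mulr_ge0// ltW.
  by rewrite !exprMn; lra.
rewrite integralB//; [|exact: finite_measure_integrable_cst|exact: ief].
rewrite integral_cst// [X in (_ * X)%E]probability_setT mule1
  (integralZl measurableT (ib q)) /= iE.
rewrite -EFinM -EFinB lee_fin => g.
rewrite -(ler_pM2l e0) !mulrDr [e * (a / e)]mulrC divfK ?gt_eqF//.
lra.
Qed.

End entropy_bounds.

(** * Infima of affine functions on a segment *)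

Section concave_ivt.
Context (R : realType) (I : Type) (P : set I) (A B : I -> R) (f : R -> R).
Hypothesis f_le : forall s i, 0 <= s <= 1 -> P i ->
  f s <= (1 - s) * A i + s * B i.
Hypothesis f_ge : forall s c, 0 <= s <= 1 ->
  (forall i, P i -> c <= (1 - s) * A i + s * B i) -> c <= f s.

(** The hypotheses say that [f] is on [[0, 1]] the infimum of the affine functions
    with end values [A i] and [B i], for [i] in [P].  Such an [f] is concave and
    upper semicontinuous, and has the intermediate value property: [m] is taken at
    the least [s] with [m <= f s]. *)
Lemma inf_affine_IVT (m : R) : f 0 <= m <= f 1 ->
  exists2 s, 0 <= s <= 1 & f s = m.
Proof.
move=> /andP[f0m mf1].
pose S := [set s | 0 <= s <= 1 /\ m <= f s].
have S1 : S 1 by split => //; rewrite ler01 lexx.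
have hS : has_inf S by split; [exists 1|exists 0 => s [/andP[]]].
have S_ge s : S s -> inf S <= s by apply: ge_inf; exact: hS.2.
have s01 : 0 <= inf S <= 1.
  rewrite S_ge// andbT; apply: lb_le_inf; first exact: hS.1.
  by move=> s [/andP[]].
(* Closedness of [S]: each affine function is at least [m] at points of [S]
   that are arbitrarily close to [inf S]. *)
have mf : m <= f (inf S).
  apply: f_ge => // i Pi; apply/ler_addgt0Pr => e e0.
  have d0 : 0 < e / (1 + `|B i - A i|) by rewrite divr_gt0// ltr_pwDl.
  have [s [s01' ms] sS] := inf_adherent d0 hS.
  have := le_trans ms (f_le s01' Pi).
  have sS' : 0 <= s - inf S by rewrite subr_ge0 S_ge.
  have : (s - inf S) * (B i - A i) <= e.
    apply: (@le_trans _ _ ((s - inf S) * (1 + `|B i - A i|))).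
      by rewrite ler_wpM2l// (le_trans (ler_norm _))// lerDr.
    by rewrite -ler_pdivlMr ?ltr_pwDl// lerBlDl ltW.
  by lra.
exists (inf S) => //; apply/eqP; rewrite eq_le mf andbT leNgt; apply/negP => mlt.
have df : 0 < f (inf S) - f 0 by rewrite subr_gt0 (le_lt_trans f0m).
(* Otherwise, by concavity on [[0, inf S]], the value of [f] at the smaller
   point [t * inf S] would still be at least [m]. *)
pose t := (m - f 0) / (f (inf S) - f 0).
have t0 : 0 <= t by apply: divr_ge0; [rewrite subr_ge0|exact: ltW].
have t1 : t < 1 by rewrite ltr_pdivrMr// mul1r ltrD2r.
have tE : t * (f (inf S) - f 0) = m - f 0 by rewrite /t divfK// gt_eqF.
have [i0 i1] := andP s01.
have ts01 : 0 <= t * inf S <= 1 by rewrite mulr_ge0//= mulr_ile1// ltW.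
have tS : S (t * inf S).
  split => //; apply: f_ge => // i Pi.
  have := f_le s01 Pi; have z01 : 0 <= (0 : R) <= 1 by rewrite lexx /=.
  have := f_le z01 Pi; rewrite subr0 mul1r mul0r addr0 => h0 h1.
  have := ler_wpM2l t0 h1.
  have t1' : 0 <= 1 - t by rewrite subr_ge0 ltW.
  have := ler_wpM2l t1' h0.
  by lra.
have := S_ge _ tS; have : 0 < inf S.
  rewrite lt_neqAle i0 andbT; apply/eqP => iS0.
  by move: df; rewrite -iS0 subrr ltxx.
by move=> ? ?; nra.
Qed.

End concave_ivt.

(** * The Stieltjes transform *)

Section stieltjes.
Context (R : realType) (xi : R).
Implicit Types nu : {finite_measure set (measurableTypeR R) -> \bar R}.

(** The integral of [1 / (theta - x)] over [x <= xi] that occurs in [F]; it is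
    used for [theta > xi]. *)
Definition stieltjes nu (theta : R) : R :=
  \int[nu]_(x in `]-oo, xi]) (theta - x)^-1.

Lemma measurable_resolvent (theta : R) : xi < theta ->
  measurable_fun (`]-oo, xi]%classic : set (measurableTypeR R))
    (fun x : measurableTypeR R => (theta - x)^-1).
Proof.
move=> xt; apply: (eq_measurable_fun
    (fun x : measurableTypeR R => expR (- ln (theta - x)))).
  move=> x; rewrite inE /= in_itv/= => xxi.
  have tx : 0 < theta - x by rewrite subr_gt0 (le_lt_trans xxi).
  by rewrite -lnV ?posrE// lnK// posrE invr_gt0.
apply: measurableT_comp => //; apply: measurableT_comp => //.
apply: measurableT_comp => //; apply: measurable_funB => //.
Qed.

Lemma resolvent_gt0 (theta x : R) : xi < theta -> x \in `]-oo, xi] -> 0 < (theta - x)^-1.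
Proof.
by move=> xt; rewrite in_itv/= => xxi; rewrite invr_gt0 subr_gt0 (le_lt_trans xxi).
Qed.

Lemma resolvent_le (theta x : R) : xi < theta -> x \in `]-oo, xi] ->
  (theta - x)^-1 <= (theta - xi)^-1.
Proof.
move=> xt; rewrite in_itv/= => xxi.
by rewrite lef_pV2 ?posrE ?subr_gt0// ?(le_lt_trans xxi)// lerD2l lerN2.
Qed.

Lemma measurable_ray : measurable (`]-oo, xi]%classic : set (measurableTypeR R)).
Proof. exact: measurable_itv. Qed.

Lemma integrable_resolvent nu (theta : R) : xi < theta ->
  nu.-integrable `]-oo, xi] (fun x => ((theta - x)^-1)%:E).
Proof.
move=> xt.
apply: (@le_integrable _ _ _ nu _ measurable_ray _ (cst ((theta - xi)^-1)%:E)).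
- by apply/measurable_EFinP; exact: measurable_resolvent.
- move=> x /= xxi; rewrite lee_fin ger0_norm; last by rewrite ltW// resolvent_gt0.
  rewrite ger0_norm; first exact: resolvent_le.
  by rewrite invr_ge0 subr_ge0 ltW.
- exact: (finite_measure_integrable_cst nu _ measurable_ray).
Qed.

Lemma stieltjesE nu (theta : R) : xi < theta ->
  (\int[nu]_(x in `]-oo, xi]) ((theta - x)^-1)%:E = (stieltjes nu theta)%:E)%E.
Proof.
move=> xt; rewrite /stieltjes /Rintegral fineK//.
exact: (integrable_fin_num measurable_ray (integrable_resolvent nu xt)).
Qed.

Lemma stieltjes_ge0 nu (theta : R) : xi < theta -> 0 <= stieltjes nu theta.
Proof.
by move=> xt; apply: Rintegral_ge0 => x xxi; rewrite ltW// resolvent_gt0.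
Qed.

Lemma stieltjes_lincomb (a b : R) nu1 nu2 (theta : R) : 0 <= a -> 0 <= b ->
  xi < theta -> stieltjes (lincomb a b nu1 nu2) theta =
    a * stieltjes nu1 theta + b * stieltjes nu2 theta.
Proof.
move=> a0 b0 xt; apply: EFin_inj; rewrite -stieltjesE//.
rewrite ge0_integral_lincomb//; last 2 first.
- by move=> x xxi; rewrite lee_fin ltW// resolvent_gt0.
- by apply/measurable_EFinP; exact: measurable_resolvent.
by rewrite !stieltjesE// EFinD !EFinM.
Qed.

Lemma stieltjes_dirac (a theta : R) : a <= xi -> xi < theta ->
  stieltjes (dirac (a : measurableTypeR R)) theta = (theta - a)^-1.
Proof.
move=> axi xt; apply: EFin_inj; rewrite -stieltjesE//.
rewrite integral_dirac//; last first.
  by apply/measurable_EFinP; exact: measurable_resolvent.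
by rewrite diracE mem_set ?mul1e//= in_itv.
Qed.

Lemma stieltjes_mzero (theta : R) : xi < theta ->
  stieltjes (mzero : {finite_measure set (measurableTypeR R) -> \bar R}) theta = 0.
Proof.
move=> xt; apply: EFin_inj; rewrite -stieltjesE//.
by rewrite integral_measure_zero.
Qed.

End stieltjes.

(** * The functional F *)

Section F_lemmas.
Context (R : realType) (xi Gamma : R).
Hypothesis Gamma_gt0 : 0 < Gamma.
Implicit Types nu : {finite_measure set (measurableTypeR R) -> \bar R}.
Let S := stieltjes xi.

Let Gamma_ge0 : 0 <= Gamma. Proof. exact: ltW. Qed.

Lemma F_le nu (theta : R) : xi < theta ->
  2 * F xi nu Gamma <= theta + Gamma * S nu theta.
Proof.
move=> xt; rewrite /F mulrA divff// mul1r; apply: ge_inf.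
  exists xi => _ [t + <-]; rewrite /= in_itv/= andbT => xt'.
  rewrite (le_trans (ltW xt'))// lerDl mulr_ge0//; exact: stieltjes_ge0.
by exists theta => //=; rewrite in_itv/= xt.
Qed.

Lemma F_ge nu (m : R) :
  (forall theta, xi < theta -> m <= theta + Gamma * S nu theta) ->
  m <= 2 * F xi nu Gamma.
Proof.
move=> mle; rewrite /F mulrA divff// mul1r; apply: lb_le_inf.
  by exists (xi + 1 + Gamma * S nu (xi + 1)), (xi + 1) => //=; rewrite in_itv/= ltrDl ltr01.
by move=> _ [t + <-]; rewrite /= in_itv/= andbT => xt; exact: mle.
Qed.

Lemma F_near nu (e : R) : 0 < e ->
  exists2 theta, xi < theta & theta + Gamma * S nu theta < 2 * F xi nu Gamma + e.
Proof.
move=> e0; apply/not_exists2P => h.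
have : 2 * F xi nu Gamma + e <= 2 * F xi nu Gamma.
  apply: F_ge => t xt; rewrite leNgt; apply/negP => tlt.
  by case: (h t).
by rewrite gerDl leNgt e0.
Qed.

Lemma F_concave nu1 nu2 (s : R) : 0 <= s <= 1 ->
  (1 - s) * F xi nu1 Gamma + s * F xi nu2 Gamma <=
  F xi (lincomb (1 - s) s nu1 nu2) Gamma.
Proof.
move=> /andP[s0 s1]; have s'0 : 0 <= 1 - s by rewrite subr_ge0.
rewrite -(ler_pM2l (ltr0Sn R 1)); apply: F_ge => t xt.
rewrite /S stieltjes_lincomb//.
have := ler_wpM2l s'0 (F_le nu1 xt); have := ler_wpM2l s0 (F_le nu2 xt).
by rewrite /S; lra.
Qed.

Lemma F_eq nu1 nu2 : (forall theta, xi < theta -> S nu1 theta = S nu2 theta) ->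
  F xi nu1 Gamma = F xi nu2 Gamma.
Proof.
move=> S12; apply: (mulfI (x := 2)); first by rewrite pnatr_eq0.
apply/eqP; rewrite eq_le; apply/andP; split; apply: F_ge => t xt.
  by rewrite -S12// F_le.
by rewrite S12// F_le.
Qed.

Lemma F_lincomb10 nu1 nu2 : F xi (lincomb (1 - 0) 0 nu1 nu2) Gamma = F xi nu1 Gamma.
Proof.
apply: F_eq => t xt; rewrite /S subr0 stieltjes_lincomb//.
by rewrite mul1r mul0r addr0.
Qed.

Lemma F_lincomb01 nu1 nu2 : F xi (lincomb (1 - 1) 1 nu1 nu2) Gamma = F xi nu2 Gamma.
Proof.
apply: F_eq => t xt; rewrite /S subrr stieltjes_lincomb//.
by rewrite mul1r mul0r add0r.
Qed.

Lemma F_IVT nu1 nu2 (m : R) : F xi nu1 Gamma <= m <= F xi nu2 Gamma ->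
  exists2 s, 0 <= s <= 1 & F xi (lincomb (1 - s) s nu1 nu2) Gamma = m.
Proof.
move=> mF; pose f s := 2 * F xi (lincomb (1 - s) s nu1 nu2) Gamma.
have fle s i : 0 <= s <= 1 -> (`]xi, +oo[)%classic i ->
    f s <= (1 - s) * (i + Gamma * S nu1 i) + s * (i + Gamma * S nu2 i).
  move=> /andP[s0 s1]; rewrite /= in_itv/= andbT => xt.
  have s'0 : 0 <= 1 - s by rewrite subr_ge0.
  apply: le_trans (F_le _ xt) _; rewrite /S stieltjes_lincomb//.
  by rewrite le_eqVlt; apply/orP; left; apply/eqP; ring.
have fge s c : 0 <= s <= 1 -> (forall i, (`]xi, +oo[)%classic i ->
    c <= (1 - s) * (i + Gamma * S nu1 i) + s * (i + Gamma * S nu2 i)) -> c <= f s.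
  move=> /andP[s0 s1] h; have s'0 : 0 <= 1 - s by rewrite subr_ge0.
  apply: F_ge => t xt; rewrite /S stieltjes_lincomb//.
  have := h t; rewrite /= in_itv/= xt => /(_ isT) /le_trans; apply.
  by rewrite le_eqVlt; apply/orP; left; apply/eqP; rewrite /S; ring.
have [|s s01 fs] := inf_affine_IVT fle fge (m := 2 * m).
  by rewrite /f F_lincomb10 F_lincomb01 !ler_pM2l.
by exists s => //; apply: (mulfI (x := 2)) => //; rewrite pnatr_eq0.
Qed.

(** Intermediate values along a segment, in both orders.  A level strictly between
    the end values is attained at an interior point. *)
Lemma F_between nu1 nu2 (m : R) :
  F xi nu1 Gamma < m < F xi nu2 Gamma \/ F xi nu2 Gamma < m < F xi nu1 Gamma ->
  exists2 s, 0 < s < 1 & F xi (lincomb (1 - s) s nu1 nu2) Gamma = m.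
Proof.
have key mu1 mu2 : F xi mu1 Gamma < m < F xi mu2 Gamma ->
    exists2 s, 0 < s < 1 & F xi (lincomb (1 - s) s mu1 mu2) Gamma = m.
  move=> /andP[m1 m2]; have [|s /andP[s0 s1] Fs] := @F_IVT mu1 mu2 m.
    by rewrite !ltW.
  exists s => //; rewrite !lt_neqAle s0 s1 !andbT; apply/andP; split.
    apply/eqP => s0'; move: m1; by rewrite -Fs -s0' F_lincomb10 ltxx.
  apply/eqP => s1'; move: m2; by rewrite -Fs s1' F_lincomb01 ltxx.
case; first exact: key.
move=> /key[s /andP[s0 s1] Fs]; exists (1 - s).
  by rewrite subr_gt0 s1 ltrBlDr ltrDl.
rewrite -Fs; apply: F_eq => t xt; rewrite subKr.
have s'0 : 0 <= 1 - s by rewrite subr_ge0 ltW.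
have s0' := ltW s0.
by rewrite /S !stieltjes_lincomb// addrC.
Qed.

(** Mixing with [kappa] lowers [F] at least linearly, uniformly over the measures
    of [C] on which [F] stays in [[a, b]].  The gap between the transforms of [nu]
    and [kappa] is at least [(a - F kappa) / Gamma] at a nearly optimal [theta0]
    for [kappa]; the comparison hypothesis on [C] carries this over, up to a
    factor, to every [theta <= 2 b + 1], hence to the nearly optimal ones for
    [nu]. *)
Lemma F_decrease kappa
    (C : set {finite_measure set (measurableTypeR R) -> \bar R}) (a b : R) :
  (forall theta0 T, xi < theta0 -> exists2 r, 0 < r &
     forall nu theta, C nu -> xi < theta <= T ->
       r * (S nu theta0 - S kappa theta0) <= S nu theta - S kappa theta) ->
  F xi kappa Gamma < a ->
  exists2 c, 0 < c & forall nu s, C nu -> a <= F xi nu Gamma <= b -> 0 <= s <= 1 ->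
    F xi (lincomb (1 - s) s nu kappa) Gamma <= F xi nu Gamma - c * s.
Proof.
move=> Ccmp Fka.
have eta0 : 0 < a - F xi kappa Gamma by rewrite subr_gt0.
have [t0 xt0 t0lt] := F_near kappa eta0.
have [r r0 rP] := Ccmp t0 (2 * b + 1) xt0.
exists (2^-1 * r * (a - F xi kappa Gamma)); first by rewrite !mulr_gt0// invr_gt0.
move=> nu s Cnu /andP[aF Fb] /andP[s0 s1]; have s'0 : 0 <= 1 - s by rewrite subr_ge0.
apply/ler_addgt0Pr => e e0.
have e10 : 0 < Num.min e 1 by rewrite lt_min e0 ltr01.
have [t xt tlt] := F_near nu e10.
have [mine min1] : Num.min e 1 <= e /\ Num.min e 1 <= 1 by rewrite !ge_min !lexx orbT.
have tT : t <= 2 * b + 1.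
  have : 0 <= Gamma * S nu t by rewrite mulr_ge0//; exact: stieltjes_ge0.
  by lra.
have := rP nu t Cnu; rewrite xt tT => /(_ isT).
have := F_le nu xt0.
have := F_le (lincomb (1 - s) s nu kappa) xt.
rewrite {1}/S stieltjes_lincomb// -/(S nu t) -/(S kappa t).
set Sn := S nu t in tlt *; set Sk := S kappa t.
set Sn0 := S nu t0; set Sk0 := S kappa t0 in t0lt *.
move=> h1 h2 h3.
have h4 : a - F xi kappa Gamma <= Gamma * (Sn0 - Sk0).
  by rewrite /Sn0 /Sk0 in h2 t0lt *; lra.
have h5 : r * (a - F xi kappa Gamma) <= Gamma * (Sn - Sk).
  apply: (@le_trans _ _ (r * (Gamma * (Sn0 - Sk0)))); first by rewrite ler_pM2l.
  by rewrite mulrCA ler_pM2l.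
have := ler_wpM2l s0 h5.
by lra.
Qed.

End F_lemmas.

(** * The rate function of a convex class of measures *)

Section stieltjes_entropy.
Context (R : realType) (q : probability (measurableTypeR R) R).

Lemma stieltjes_le_H (xi a e theta : R)
    (nu : {finite_measure set (measurableTypeR R) -> \bar R}) :
  xi < theta -> 0 < e -> e / (theta - xi) <= 2^-1 -> (H q nu <= a%:E)%E ->
  stieltjes xi nu theta <=
  stieltjes xi q theta + a / e + 2 * e * ((theta - xi)^-1) ^+ 2.
Proof.
move=> xt e0 eM Ha; rewrite /stieltjes [leLHS]Rintegral_mkcond.
rewrite [X in _ <= X + _ + _]Rintegral_mkcond.
apply: (integral_le_H _ _ e0 eM Ha).
- exact: ((measurable_restrictT _ (measurable_ray xi)).1 (measurable_resolvent xt)).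
- move=> x; rewrite patchE; case: ifPn => [|_]; rewrite ?inE.
    by move=> xD; rewrite resolvent_le// ltW// (resolvent_gt0 xt).
  by rewrite lexx/= invr_ge0 subr_ge0 ltW.
Qed.

End stieltjes_entropy.

Section rate_function.
Context (R : realType) (q : probability (measurableTypeR R) R) (xi Gamma : R).
Variable C : set {finite_measure set (measurableTypeR R) -> \bar R}.

(** The common form of [I_H] and [I_G]: half the least relative entropy of [q]
    with respect to a measure of the class [C] at the level [m] of [F]. *)
Definition rate (m : R) : \bar R :=
  ereal_inf [set ((2^-1)%:E * H q nu)%E | nu in
    [set nu | C nu /\ m = F xi nu Gamma]].

(* [kappa] is the bottom of the class.  The last hypothesis compares the gap
   between the transforms of [nu] and [kappa] at two points, uniformly in [nu]. *)
Variable kappa : {finite_measure set (measurableTypeR R) -> \bar R}.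
Hypothesis Gamma_gt0 : 0 < Gamma.
Hypothesis C_convex : forall nu1 nu2 s, 0 <= s <= 1 -> C nu1 -> C nu2 ->
  C (lincomb (1 - s) s nu1 nu2).
Hypotheses (Cq : C q) (Ck : C kappa) (kappa_le1 : mass kappa <= 1).
Hypothesis C_cmp : forall theta0 T, xi < theta0 -> exists2 r, 0 < r &
  forall nu theta, C nu -> xi < theta <= T ->
    r * (stieltjes xi nu theta0 - stieltjes xi kappa theta0) <=
    stieltjes xi nu theta - stieltjes xi kappa theta.

Let Fx nu := F xi nu Gamma.
Let attainable m := exists2 nu, C nu & m < Fx nu.

Lemma rate_ge0 m : (0 <= rate m)%E.
Proof.
apply: le_ereal_inf_tmp => _ [nu _ <-].
by rewrite mule_ge0 ?lee_fin ?invr_ge0//; exact: H_ge0.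
Qed.

Lemma rate_le nu a : C nu -> (H q nu <= a%:E)%E -> (rate (Fx nu) <= (a / 2)%:E)%E.
Proof.
move=> Cnu Ha; apply: ge_ereal_inf; exists ((2^-1)%:E * H q nu)%E; first by exists nu.
by rewrite mulrC EFinM lee_wpmul2l.
Qed.

Lemma rate_lt m b : (rate m < b%:E)%E ->
  exists nu, [/\ C nu, Fx nu = m & (H q nu <= (2 * b)%:E)%E].
Proof.
move=> /ereal_inf_lt[_ [nu [Cnu mF] <-] Hb]; exists nu; split => //.
have := lee_wpmul2l (_ : 0 <= 2%:E)%E (ltW Hb).
by rewrite muleA -EFinM divff// mul1e -EFinM; apply; rewrite lee_fin.
Qed.

Lemma H_self_le a : 0 <= a -> (H q q <= a%:E)%E.
Proof. by move=> a0; apply: le_trans (H_self_le0 q) _; rewrite lee_fin. Qed.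

(** Every level between [F q] and [F nu] is reached on the segment from [q] to
    [nu], where the entropy is at most [H(q|nu)]. *)
Lemma rate_mix_le nu a m : C nu -> (H q nu <= a%:E)%E ->
  Fx q <= m <= Fx nu \/ Fx nu <= m <= Fx q -> (rate m <= (a / 2)%:E)%E.
Proof.
move=> Cnu Ha mF.
have a0 : 0 <= a by have := le_trans (H_ge0 q nu) Ha; rewrite lee_fin.
have [<-|mq] := eqVneq (Fx q) m; first by apply: rate_le => //; exact: H_self_le.
have [<-|mnu] := eqVneq (Fx nu) m; first exact: rate_le.
have [|s s01 <-] := @F_between _ xi _ Gamma_gt0 q nu m.
  have qm : m != Fx q by rewrite eq_sym.
  have num : m != Fx nu by rewrite eq_sym.
  case: mF => /andP[m1 m2]; [left|right].
    by rewrite !lt_neqAle mq m1 num.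
  by rewrite !lt_neqAle mnu m1 qm.
have /andP[s0 s1] := s01.
apply: rate_le; first by apply: C_convex => //; rewrite !ltW.
apply: le_trans (H_convex s01 (H_self_le (lexx 0)) Ha) _.
by rewrite mulr0 add0r lee_fin ler_piMl// ltW.
Qed.

Lemma rate_q : rate (Fx q) = 0%E.
Proof.
apply/eqP; rewrite eq_le rate_ge0 andbT.
have := rate_le Cq (H_self_le (lexx 0)); by rewrite mul0r.
Qed.

Lemma rate_mixture_lty nu s : C nu -> 0 < s < 1 ->
  (rate (Fx (lincomb (1 - s) s q nu)) < +oo)%E.
Proof.
move=> Cnu /andP[s0 s1]; have s'0 : 0 < 1 - s by rewrite subr_gt0.
apply: le_lt_trans (rate_le _ (H_lincomb_le _ s'0 (ltW s0) (H_self_le (lexx 0)))) _.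
  by apply: C_convex => //; rewrite !ltW.
exact: ltry.
Qed.

Lemma rate_lty_right m : Fx q <= m -> attainable m -> (rate m < +oo)%E.
Proof.
rewrite le_eqVlt => /predU1P[<- _|qm [nu Cnu mnu]]; first by rewrite rate_q.
have [|s s01 <-] := @F_between _ xi _ Gamma_gt0 q nu m; first by left; rewrite qm.
exact: rate_mixture_lty.
Qed.

Lemma rate_lty m : Fx kappa < m -> attainable m -> (rate m < +oo)%E.
Proof.
move=> km am; have [qm|mq] := leP (Fx q) m; first exact: rate_lty_right.
have [|s s01 <-] := @F_between _ xi _ Gamma_gt0 q kappa m; first by right; rewrite km.
exact: rate_mixture_lty.
Qed.

Lemma rate_fin m : Fx kappa < m -> attainable m -> rate m = (fine (rate m))%:E.
Proof.
by move=> km am; rewrite fineK// ge0_fin_numE ?rate_ge0//; exact: rate_lty.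
Qed.

Lemma rate_nonincreasing x y : x <= y -> y <= Fx q -> (rate y <= rate x)%E.
Proof.
move=> xy yq; apply: le_ereal_inf_tmp => _ [nu [Cnu xF] <-].
have : (0 <= H q nu)%E := H_ge0 q nu.
case E : (H q nu) => [a| |]// _; last by rewrite gt0_muley ?leey// lte_fin invr_gt0.
rewrite -EFinM mulrC; apply: (rate_mix_le Cnu); first by rewrite E.
by right; rewrite /Fx -xF xy.
Qed.

Lemma rate_nondecreasing x y : Fx q <= x -> x <= y -> (rate x <= rate y)%E.
Proof.
move=> qx xy; apply: le_ereal_inf_tmp => _ [nu [Cnu yF] <-].
have : (0 <= H q nu)%E := H_ge0 q nu.
case E : (H q nu) => [a| |]// _; last by rewrite gt0_muley ?leey// lte_fin invr_gt0.
rewrite -EFinM mulrC; apply: (rate_mix_le Cnu); first by rewrite E.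
by left; rewrite /Fx -yF qx.
Qed.

Lemma rate_convex x y a b t : 0 <= t <= 1 -> Fx q <= x -> Fx q <= y ->
  rate x = a%:E -> rate y = b%:E ->
  (rate (t * x + (1 - t) * y) <= (t * a + (1 - t) * b)%:E)%E.
Proof.
move=> /andP[]; rewrite le_eqVlt => /predU1P[<- _|t0].
  by rewrite subr0 !mul0r !mul1r !add0r => _ _ _ ->.
rewrite le_eqVlt => /predU1P[->|t1].
  by rewrite subrr !mul0r !mul1r !addr0 => _ _ ->.
move=> qx qy xa yb; apply/lee_addgt0Pr => e e0.
have [|mu [Cmu Fmu Hmu]] := @rate_lt x (a + e); first by rewrite xa lte_fin ltrDl.
have [|nu [Cnu Fnu Hnu]] := @rate_lt y (b + e); first by rewrite yb lte_fin ltrDl.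
have s01 : 0 < 1 - t < 1 by rewrite subr_gt0 t1 ltrBlDr ltrDl.
have s01' : 0 <= 1 - t <= 1 by have /andP[? ?] := s01; rewrite !ltW.
have qz : Fx q <= t * x + (1 - t) * y.
  have : t * Fx q <= t * x by rewrite ler_pM2l.
  have : (1 - t) * Fx q <= (1 - t) * y by rewrite ler_pM2l// subr_gt0.
  by lra.
have Fz : t * x + (1 - t) * y <= Fx (lincomb (1 - (1 - t)) (1 - t) mu nu).
  have := F_concave xi Gamma_gt0 mu nu s01'; rewrite -/(Fx mu) -/(Fx nu) Fmu Fnu.
  by rewrite {1}subKr.
apply: le_trans (rate_mix_le (C_convex s01' Cmu Cnu) (H_convex s01 Hmu Hnu) _) _.
  by left; rewrite qz Fz.
by rewrite -EFinD lee_fin subKr; lra.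
Qed.

(** If [F nu = y > F q], then at a nearly optimal [t] for [q] the transform of
    [nu] exceeds that of [q] by a fixed amount, which bounds [H(q|nu)] from below
    by [stieltjes_le_H]. *)
Lemma rate_gt0 y : Fx q < y -> (0 < rate y)%E.
Proof.
move=> qy.
have d0 : 0 < y - Fx q by rewrite subr_gt0.
have [t xt tlt] := F_near xi Gamma q d0.
set M := (t - xi)^-1.
have M0 : 0 < M by rewrite invr_gt0 subr_gt0.
(* With this [e], the quadratic error term of [stieltjes_le_H] takes at most half
   of the available gap [y - F q]. *)
pose e := Num.min (2^-1 / M) ((y - Fx q) / (4 * Gamma * M ^+ 2)).
have e0 : 0 < e.
  have M20 : 0 < 4 * Gamma * M ^+ 2 by rewrite !mulr_gt0// exprn_gt0.
  by rewrite lt_min; apply/andP; split; apply: divr_gt0 => //; rewrite invr_gt0.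
have eM : e * M <= 2^-1.
  by rewrite -ler_pdivlMr// /e ge_min lexx.
have eM2 : Gamma * (2 * e * M ^+ 2) <= 2^-1 * (y - Fx q).
  have : e <= (y - Fx q) / (4 * Gamma * M ^+ 2) by rewrite /e ge_min lexx orbT.
  by rewrite ler_pdivlMr ?(mulr_gt0, exprn_gt0)//; lra.
pose eta := e * (y - Fx q) / (8 * Gamma).
have eta0 : 0 < eta by rewrite divr_gt0 ?mulr_gt0.
rewrite (@lt_le_trans _ _ eta%:E)// ?lte_fin// leNgt; apply/negP => /rate_lt.
move=> [nu [Cnu Fnu Hnu]].
have := stieltjes_le_H xt e0 eM Hnu; rewrite -/M => h1.
have := F_le Gamma_gt0 nu xt; rewrite -/(Fx nu) Fnu => h2.
have h3 : Gamma * (2 * eta / e) = 4^-1 * (y - Fx q).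
  by rewrite /eta; field; rewrite !gt_eqF.
have : Gamma * stieltjes xi nu t <= Gamma * stieltjes xi q t +
    Gamma * (2 * eta / e) + Gamma * (2 * e * M ^+ 2).
  by rewrite -!mulrDr ler_pM2l.
by rewrite h3 -/(Fx q) in tlt *; lra.
Qed.

(** By convexity on [[F q, y]], as the rate is [0] at [F q] and positive at [y]. *)
Lemma rate_increasing x y : Fx q <= x -> x < y -> (rate y < +oo)%E ->
  (rate x < rate y)%E.
Proof.
move=> qx xy yoo; have qy := le_lt_trans qx xy.
have yf : rate y \is a fin_num by rewrite ge0_fin_numE// rate_ge0.
have y0 := rate_gt0 qy; move: (y0); rewrite -(fineK yf) lte_fin => y0'.
have d0 : 0 < y - Fx q by rewrite subr_gt0.
pose t := (y - x) / (y - Fx q).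
have t0 : 0 < t by rewrite divr_gt0// subr_gt0.
have t1 : t <= 1 by rewrite ler_pdivrMr// mul1r lerD2l lerN2.
have xE : x = t * Fx q + (1 - t) * y by rewrite /t; field; rewrite gt_eqF.
have t01 : 0 <= t <= 1 by rewrite ltW.
have := rate_convex t01 (lexx _) (ltW qy) rate_q (esym (fineK yf)).
rewrite -xE => /le_lt_trans; apply.
by rewrite mulr0 add0r lte_fin gtr_pMl// ltrBlDr ltrDl.
Qed.

(** One-sided Lipschitz bound before [F q]: a near-minimiser at the level [y] is
    mixed with the proportion [s = (y - x) / c] of [kappa]. *)
Lemma rate_left_lip a : Fx kappa < a -> exists K c, [/\ 0 < c, 0 <= K &
  forall x y, a <= y -> x <= y -> y <= Fx q -> y - x <= c ->
    (rate x <= rate y + (K * (y - x))%:E)%E].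
Proof.
move=> ka.
have [c c0 cP] := F_decrease Gamma_gt0 (Fx q) C_cmp ka.
have K0 : 0 <= 3 / (2 * c) by rewrite divr_ge0// mulr_ge0// ltW.
exists (3 / (2 * c)), (c / 2); split => //; first by rewrite divr_gt0.
move=> x y ay xy yq yxc.
apply/lee_addgt0Pr => e e0.
have := rate_ge0 y; case E : (rate y) => [r| |]// _; last by rewrite !addye ?leey.
have [|nu [Cnu Fnu Hnu]] := @rate_lt y (r + e); first by rewrite E lte_fin ltrDl.
pose s := (y - x) / c.
have s0 : 0 <= s by rewrite divr_ge0 ?subr_ge0// ltW.
have s2 : s <= 2^-1 by rewrite ler_pdivrMr// mulrC.
have s1 : 0 < 1 - s by lra.
have s01 : 0 <= s <= 1 by rewrite s0/=; lra.
have Fs : Fx (lincomb (1 - s) s nu kappa) <= x.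
  have := cP nu s Cnu; rewrite -/(Fx nu) Fnu ay yq => /(_ isT s01)/le_trans; apply.
  by rewrite /s mulrC divfK ?gt_eqF// subKr.
have := rate_mix_le (C_convex s01 Cnu Ck) (H_lincomb_le kappa s1 s0 Hnu)
  (or_intror _).
move=> /(_ x); rewrite Fs (le_trans xy yq) => /(_ isT)/le_trans; apply.
rewrite -!EFinD lee_fin mass_lincomb//; last exact: ltW.
have ln_ge : - (2 * s) <= ln (1 - s).
  by apply: le_trans (ln1B_ge _); [nra|rewrite s0].
have sk : s * mass kappa <= s by rewrite ler_piMr.
have sn : 0 <= s * mass nu by rewrite mulr_ge0// mass_ge0.
have -> : 3 / (2 * c) * (y - x) = 3 / 2 * s.
  by rewrite /s; field; rewrite gt_eqF.
lra.
Qed.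

(** Slopes of a convex function increase, and the rate is nonnegative. *)
Lemma rate_right_lip x y z : Fx q <= x -> x <= y -> y < z -> (rate z < +oo)%E ->
  fine (rate y) - fine (rate x) <= fine (rate z) / (z - y) * (y - x).
Proof.
move=> qx xy yz zoo.
have finr w : Fx q <= w -> w <= z -> rate w = (fine (rate w))%:E.
  move=> qw wz; rewrite fineK// ge0_fin_numE ?rate_ge0//.
  exact: le_lt_trans (rate_nondecreasing qw wz) zoo.
have xz : x < z := le_lt_trans xy yz.
have zx0 : 0 < z - x by rewrite subr_gt0.
have zy0 : 0 < z - y by rewrite subr_gt0.
pose t := (z - y) / (z - x).
have t0 : 0 <= t by rewrite divr_ge0// ltW.
have t1 : t <= 1 by rewrite ler_pdivrMr// mul1r lerD2l lerN2.
have yE : y = t * x + (1 - t) * z by rewrite /t; field; rewrite gt_eqF.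
have qz : Fx q <= z by rewrite (le_trans qx)// ltW.
have t01 : 0 <= t <= 1 by rewrite t0.
have := rate_convex t01 qx qz (finr _ qx (ltW xz)) (finr _ qz (lexx z)).
rewrite -yE (finr y (le_trans qx xy) (ltW yz)) lee_fin => h.
have gx0 : 0 <= fine (rate x) by rewrite fine_ge0// rate_ge0.
have gz0 : 0 <= fine (rate z) by rewrite fine_ge0// rate_ge0.
have tE : 1 - t = (y - x) / (z - x) by rewrite /t; field; rewrite gt_eqF.
have : (1 - t) * fine (rate z) <= fine (rate z) / (z - y) * (y - x).
  rewrite tE mulrC mulrA mulrAC ler_wpM2r ?subr_ge0//.
  by rewrite ler_wpM2l// lef_pV2 ?posrE// lerD2l lerN2.
have : t * fine (rate x) <= fine (rate x) by rewrite ler_piMl.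
by lra.
Qed.

Lemma rate_continuous m : Fx kappa < m -> attainable m -> {for m, continuous rate}.
Proof.
move=> km [nut Ct mt].
set w := Fx nut in mt.
pose a := (Fx kappa + m) / 2; pose b := (m + w) / 2; pose z := (b + w) / 2.
have [ka am mb bz zw] : [/\ Fx kappa < a, a < m, m < b, b < z & z < w].
  by rewrite /z /b /a; split; lra.
have fing x : a <= x -> x < w -> rate x = (fine (rate x))%:E.
  by move=> ax xw; apply: rate_fin; [exact: lt_le_trans ax|exists nut].
have [K1 [c [c0 K10 K1P]]] := rate_left_lip ka.
pose K2 := fine (rate z) / (z - b).
have K20 : 0 <= K2 by rewrite divr_ge0 ?fine_ge0 ?rate_ge0// subr_ge0 ltW.
have zoo : (rate z < +oo)%E.
  by apply: rate_lty; [lra|exists nut].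
have LR u v : a <= u -> Fx q <= u -> u <= v -> v <= b ->
    `|fine (rate u) - fine (rate v)| <= K2 * (v - u).
  move=> au qu uv vb.
  have fu : rate u = (fine (rate u))%:E by apply: fing; lra.
  have fv : rate v = (fine (rate v))%:E by apply: fing; lra.
  have : (rate u <= rate v)%E by exact: rate_nondecreasing.
  rewrite fu fv lee_fin => guv.
  rewrite ler0_norm ?subr_le0// opprB.
  apply: le_trans (rate_right_lip qu uv _ zoo) _; first by lra.
  rewrite ler_wpM2r ?subr_ge0// ler_wpM2l ?fine_ge0 ?rate_ge0//.
  by rewrite lef_pV2 ?posrE; lra.
have LL u v : a <= u -> u <= v -> v <= Fx q -> v <= b -> v - u <= c ->
    `|fine (rate u) - fine (rate v)| <= K1 * (v - u).
  move=> au uv vq vb vuc.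
  have fu : rate u = (fine (rate u))%:E by apply: fing; lra.
  have fv : rate v = (fine (rate v))%:E by apply: fing; lra.
  have : (rate v <= rate u)%E by exact: rate_nonincreasing.
  have := K1P u v (le_trans au uv) uv vq vuc.
  rewrite fu fv -EFinD !lee_fin => h1 h2.
  by rewrite ger0_norm ?subr_ge0// lerBlDl.
(* If [F q] lies between [u] and [v], the two bounds are chained at [F q]. *)
have L u v : a <= u -> u <= v -> v <= b -> v - u <= c ->
    `|fine (rate u) - fine (rate v)| <= (K1 + K2) * (v - u).
  move=> au uv vb vuc.
  have vu0 : 0 <= v - u by rewrite subr_ge0.
  have [vq|qv] := leP v (Fx q).
    apply: le_trans (LL _ _ au uv vq vb vuc) _.
    by rewrite ler_wpM2r// lerDl.
  have [qu|uq] := leP (Fx q) u.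
    apply: le_trans (LR _ _ au qu uv vb) _.
    by rewrite ler_wpM2r// lerDr.
  apply: le_trans (ler_distD (fine (rate (Fx q))) _ _) _.
  have := LL u (Fx q) au (ltW uq) (lexx _); have := LR (Fx q) v; nra.
have fm : rate m = (fine (rate m))%:E by apply: fing; lra.
suff : rate x @[x --> m] --> (fine (rate m))%:E by rewrite -fm.
apply: cvg_EFin.
  apply/nbhs_ballP; exists (Num.min (m - a) (w - m)) => /=.
    by rewrite lt_min !subr_gt0 am.
  move=> x; rewrite /ball/= lt_min !ltr_norml => /andP[/andP[_ h1] /andP[h2 _]].
  by rewrite fing; [|lra..].
apply/cvgrPdist_le => e e0; apply/nbhs_ballP.
pose d := Num.min (Num.min (m - a) (b - m)) (Num.min c (e / (K1 + K2 + 1))).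
have K0 : 0 < K1 + K2 + 1 by rewrite ltr_pwDr// addr_ge0.
exists d => /=; first by rewrite !lt_min !subr_gt0 am mb c0 divr_gt0.
move=> x; rewrite /ball/= !lt_min => /andP[/andP[h1 h2] /andP[h3 h4]].
have {}h4 : (K1 + K2) * `|m - x| <= e.
  move: h4; rewrite ltr_pdivlMr// mulrC => /ltW; apply: le_trans.
  by rewrite ler_wpM2r// lerDl.
apply: le_trans h4; have [mx|xm] := leP m x.
  rewrite [`|m - x|]ler0_norm ?subr_le0// opprB in h1 h2 h3 *.
  by apply: L => //; lra.
rewrite [`|m - x|]gtr0_norm ?subr_gt0// in h1 h2 h3 *.
by rewrite distrC; apply: L => //; lra.
Qed.

(** The upper end [b] of the range of levels may be infinite. *)
Lemma rate_profile (mk : R) (b : itv_bound R) : Fx kappa <= mk ->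
  (forall m, m \in Interval -oo%O b -> attainable m) ->
  [/\ {within [set` Interval (BRight mk) b], continuous rate},
      nonincreasing_on `]mk, Fx q] rate,
      convex_on [set` Interval (BLeft (Fx q)) b] rate &
      strictly_increasing_on [set` Interval (BLeft (Fx q)) b] rate].
Proof.
move=> kmk att.
have itvl l m : m \in Interval l b -> attainable m.
  by move=> mI; apply: att; move: mI; rewrite !itv_boundlr => /andP[_ ->].
have itvq m : m \in Interval (BLeft (Fx q)) b -> Fx q <= m.
  by rewrite itv_boundlr => /andP[].
have fin m : m \in Interval (BLeft (Fx q)) b -> rate m = (fine (rate m))%:E.
  move=> mI; rewrite fineK// ge0_fin_numE ?rate_ge0//.
  by apply: rate_lty_right; [exact: itvq|exact: itvl mI].
split.
- apply: continuous_in_subspaceT => m; rewrite inE /= => mI.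
  apply: rate_continuous; last exact: itvl mI.
  by apply: le_lt_trans kmk _; move: mI; rewrite itv_boundlr => /andP[].
- move=> x y _; rewrite /= in_itv/= => /andP[_ yq] xy.
  exact: rate_nonincreasing.
- move=> t x y t01 xI yI; rewrite (fin x xI) (fin y yI) -!EFinM -EFinD.
  by apply: rate_convex => //; [exact: itvq|exact: itvq|exact: fin|exact: fin].
- move=> x y xI yI xy; apply: rate_increasing => //; first exact: itvq.
  by rewrite (fin y yI) ltry.
Qed.

End rate_function.

(** * The two classes of measures *)

Section comparison.
Context (R : realType) (lm lp : R).
Hypothesis lmp : lm <= lp.
Implicit Types nu : {finite_measure set (measurableTypeR R) -> \bar R}.

(** Distances from two points beyond [lp] to a point [x <= lp] are comparable,
    uniformly in [x]. *)
Lemma distance_ratio (theta0 T : R) : lp < theta0 -> exists2 r, 0 < r &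
  forall theta x, lp < theta <= T -> x <= lp -> r * (theta - x) <= theta0 - x.
Proof.
move=> lt0.
have d0 : 0 < `|T - lp| + 1 by rewrite ltr_wpDl.
exists (Num.min 1 ((theta0 - lp) / (`|T - lp| + 1))).
  by rewrite lt_min ltr01 divr_gt0// subr_gt0.
set r := Num.min _ _; move=> theta x /andP[lt tT] xl.
have r0 : 0 < r by rewrite lt_min ltr01 divr_gt0// subr_gt0.
have r1 : r <= 1 by rewrite ge_min lexx.
have : r * (`|T - lp| + 1) <= theta0 - lp.
  by rewrite -ler_pdivlMr// /r ge_min lexx orbT.
have := ler_norm (T - lp).
by nra.
Qed.

(** The comparison hypothesis for all finite measures, with [kappa = 0]. *)
Lemma stieltjes_mzero_cmp (theta0 T : R) : lp < theta0 -> exists2 r, 0 < r &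
  forall nu theta, lp < theta <= T ->
    r * (stieltjes lp nu theta0 - stieltjes lp mzero theta0) <=
    stieltjes lp nu theta - stieltjes lp mzero theta.
Proof.
move=> lt0; have [r r0 rP] := distance_ratio T lt0; exists r => // nu theta ltT.
have /andP[lt _] := ltT.
rewrite !stieltjes_mzero// !subr0.
rewrite -(RintegralZl r (measurable_ray lp) (integrable_resolvent nu lt0)).
apply: le_Rintegral.
- exact: measurable_ray.
- have := integrableZl (measurable_ray lp) r (integrable_resolvent nu lt0).
  by apply: eq_integrable => //; exact: measurable_ray.
- exact: integrable_resolvent.
move=> x /=; rewrite in_itv/= => xl.
have t0x : 0 < theta0 - x by rewrite subr_gt0 (le_lt_trans xl).
have tx : 0 < theta - x by rewrite subr_gt0 (le_lt_trans xl).
by rewrite ler_pdivrMr// mulrC ler_pdivlMr// rP.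
Qed.

Lemma stieltjes_supported nu (theta : R) : lp < theta -> supported_on `[lm, lp] nu ->
  stieltjes lp nu theta = \int[nu]_(x in `[lm, lp]) (theta - x)^-1.
Proof.
move=> lt snu; rewrite /stieltjes /Rintegral; congr fine.
have mI : measurable (`[lm, lp]%classic : set (measurableTypeR R)).
  exact: measurable_itv.
rewrite (negligible_integral (measurableC mI) (measurable_ray lp) (integrable_resolvent nu lt) snu).
congr integral; rewrite setDE setCK; apply/seteqP; split => x /=; rewrite !in_itv/=.
  by move=> [].
by move=> /andP[-> ->].
Qed.

(** The comparison hypothesis for the probability measures on [[lm, lp]], with
    [kappa] the Dirac mass at [lm].  The difference of the transforms is the
    integral of [(x - lm) / ((theta - x) * (theta - lm))], nonnegative on
    [[lm, lp]], and [distance_ratio] applies to each of the two factors of the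
    denominator. *)
Lemma stieltjes_dirac_cmp (theta0 T : R) : lp < theta0 -> exists2 r, 0 < r &
  forall nu theta, supported_on `[lm, lp] nu /\ mass nu = 1 -> lp < theta <= T ->
    r * (stieltjes lp nu theta0 - stieltjes lp (dirac (lm : measurableTypeR R)) theta0) <=
    stieltjes lp nu theta - stieltjes lp (dirac (lm : measurableTypeR R)) theta.
Proof.
move=> lt0; have [r r0 rP] := distance_ratio T lt0.
exists (r ^+ 2); first by rewrite exprn_gt0.
move=> nu theta [snu nu1] ltT; have /andP[lt _] := ltT.
have mI : measurable (`[lm, lp]%classic : set (measurableTypeR R)).
  exact: measurable_itv.
have nuI : fine (nu `[lm, lp]%classic) = 1.
  rewrite -nu1 /mass -(setUv `[lm, lp]%classic) measureU ?setICr//.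
    by rewrite [X in (_ + X)%E]snu adde0.
  by apply: measurableC.
have iI (t : R) : lp < t ->
    nu.-integrable `[lm, lp] (EFin \o (fun x => (t - x)^-1)).
  move=> ltt; apply: integrableS (integrable_resolvent nu ltt) => //.
  by move=> x /=; rewrite !in_itv/= => /andP[].
have iC (c : R) : nu.-integrable `[lm, lp] (EFin \o (fun=> c)).
  exact: finite_measure_integrable_cst.
have iB (t : R) : lp < t ->
    nu.-integrable `[lm, lp] (EFin \o (fun x => (t - x)^-1 - (t - lm)^-1)).
  by move=> ltt; exact: (integrableB mI (iI t ltt) (iC _)).
have BE (t : R) : lp < t -> stieltjes lp nu t - (t - lm)^-1 =
    \int[nu]_(x in `[lm, lp]) ((t - x)^-1 - (t - lm)^-1).
  move=> ltt; rewrite (RintegralB mI (iI t ltt) (iC _)) -stieltjes_supported//.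
  by rewrite Rintegral_cst// nuI mulr1.
rewrite !stieltjes_dirac// !BE// -(RintegralZl (r ^+ 2) mI (iB _ lt0)).
apply: le_Rintegral => //.
- exact: (integrableZl mI (r ^+ 2) (iB _ lt0)).
- exact: iB.
move=> x /=; rewrite in_itv/= => /andP[lx xl].
have t0x : 0 < theta0 - x by rewrite subr_gt0 (le_lt_trans xl).
have tx : 0 < theta - x by rewrite subr_gt0 (le_lt_trans xl).
have t0l : 0 < theta0 - lm by rewrite subr_gt0 (le_lt_trans lmp).
have tl : 0 < theta - lm by rewrite subr_gt0 (le_lt_trans lmp).
have VB (a b : R) : 0 < a -> 0 < b -> a^-1 - b^-1 = (b - a) * (a^-1 * b^-1).
  by move=> a0 b0; field; rewrite !gt_eqF.
have rV (a b : R) : 0 < a -> 0 < b -> r * a <= b -> r * b^-1 <= a^-1.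
  by move=> a0 b0 rab; rewrite ler_pdivrMr// mulrC ler_pdivlMr.
rewrite !VB// (_ : theta0 - lm - (theta0 - x) = x - lm); last by ring.
rewrite (_ : theta - lm - (theta - x) = x - lm); last by ring.
rewrite mulrCA ler_wpM2l ?subr_ge0// expr2 mulrACA.
apply: ler_pM.
- by apply: mulr_ge0; [exact: ltW|rewrite invr_ge0 ltW].
- by apply: mulr_ge0; [exact: ltW|rewrite invr_ge0 ltW].
- by apply: rV => //; exact: rP.
- by apply: rV => //; exact: rP.
Qed.

End comparison.

Lemma F_mzero (R : realType) (xi Gamma : R) : 0 < Gamma ->
  F xi mzero Gamma = xi / 2.
Proof.
move=> G0; apply: (mulfI (x := 2)) => //; rewrite [RHS](_ : _ = xi); last by field.
apply/eqP; rewrite eq_le; apply/andP; split.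
  apply/ler_addgt0Pr => e e0.
  have xe : xi < xi + e by rewrite ltrDl.
  apply: le_trans (F_le G0 _ xe) _.
  by rewrite stieltjes_mzero// mulr0 addr0.
apply: F_ge => t xt.
by rewrite stieltjes_mzero// mulr0 addr0 ltW.
Qed.

(** For the mass [c] at [xi], [2 F] is [xi + 2 sqrt (c Gamma)]; only the lower
    bound is needed, with [c] such that [2 sqrt (c Gamma) = K]. *)
Lemma F_lincomb_dirac_unbounded (R : realType) (xi Gamma : R) : 0 < Gamma ->
  forall m, exists2 c, 0 <= c &
    m < F xi (lincomb c 0 (dirac (xi : measurableTypeR R)) mzero) Gamma.
Proof.
move=> G0 m; pose K := 2 * `|m| + `|xi| + 1.
have K0 : 0 <= K by rewrite !addr_ge0// mulr_ge0.
exists (K ^+ 2 / (4 * Gamma)); first by rewrite divr_ge0 ?exprn_ge0// mulr_ge0// ltW.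
have c0 : 0 <= K ^+ 2 / (4 * Gamma) by rewrite divr_ge0 ?exprn_ge0// mulr_ge0// ltW.
suff : xi + K <= 2 * F xi (lincomb (K ^+ 2 / (4 * Gamma)) 0
    (dirac (xi : measurableTypeR R)) mzero) Gamma.
  have := ler_norm m; have := lerNnormlW (lexx `|xi|); rewrite /K; lra.
apply: F_ge => t xt; rewrite stieltjes_lincomb// stieltjes_dirac// mul0r addr0.
have u0 : 0 < t - xi by rewrite subr_gt0.
(* With [u = t - xi], the claim is [u + (K / 2) ^+ 2 / u >= K]. *)
rewrite -subr_ge0.
have -> : t + Gamma * (K ^+ 2 / (4 * Gamma) * (t - xi)^-1) - (xi + K) =
    (t - xi - K / 2) ^+ 2 / (t - xi).
  by field; rewrite !gt_eqF.
by rewrite divr_ge0 ?sqr_ge0// ltW.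
Qed.

(** A finite measure of mass 1, as a probability measure. *)
Definition prob_of (R : realType)
    (nu : {finite_measure set (measurableTypeR R) -> \bar R}) of mass nu = 1 : set (measurableTypeR R) -> \bar R := nu.

HB.instance Definition _ (R : realType) nu (nu1 : mass nu = 1) :=
  Measure.on (@prob_of R nu nu1).

Lemma prob_of_setT (R : realType) nu (nu1 : mass nu = 1) :
  @prob_of R nu nu1 setT = 1%E.
Proof. by rewrite /prob_of massE nu1. Qed.

HB.instance Definition _ (R : realType) nu (nu1 : mass nu = 1) :=
  Measure_isProbability.Build _ _ _ (@prob_of R nu nu1) (prob_of_setT nu1).

(** [H] is defined from the structure of finite measure; it only depends on the
    underlying set function. *)
Lemma H_ext (R : realType) (q : probability (measurableTypeR R) R)
    (nu1 nu2 : {finite_measure set (measurableTypeR R) -> \bar R}) :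
  nu1 = nu2 :> (set (measurableTypeR R) -> \bar R) -> H q nu1 = H q nu2.
Proof.
suff key (m1 m2 : {finite_measure set (measurableTypeR R) -> \bar R}) :
    m1 = m2 :> (set (measurableTypeR R) -> \bar R) -> (H q m1 <= H q m2)%E.
  by move=> n12; apply/eqP; rewrite eq_le !key.
move=> m12; have := H_ge0 q m2.
case E : (H q m2) => [a| |]// _; last by rewrite leey.
have Ha : (H q m2 <= a%:E)%E by rewrite E.
have qm1 : q `<< m1 by have := H_lty_dominates Ha; rewrite m12.
have [h [mh h0 h1 ->]] := H_density qm1.
rewrite m12 in h1.
have := gibbs ltr01 mh h0 Ha (_ : _ <= 1%:E)%E; rewrite h1 lexx => /(_ isT).
have -> : mass m1 = mass m2 by rewrite /mass m12.
rewrite ln1; case: (\int[q]_x _)%E => [r| |]//; rewrite -?EFinD ?lee_fin.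
  by lra.
by move=> _; exact: leNye.
Qed.


Section rate_identification.
Context (R : realType) (q : probability (measurableTypeR R) R) (lm lp Gamma : R).

Lemma I_G_rate : I_G q lm lp Gamma = rate q lp Gamma (supported_on `[lm, lp]).
Proof. by []. Qed.

(** The infimum over the type of probability measures is the one over the finite
    measures of mass 1. *)
Lemma I_H_rate : I_H q lm lp Gamma =
  rate q lp Gamma [set nu : {finite_measure set (measurableTypeR R) -> \bar R} |
     supported_on `[lm, lp] nu /\ mass nu = 1].
Proof.
apply/funext => m; rewrite /I_H /rate; congr ereal_inf; apply/seteqP; split.
  by move=> _ [nu [snu mF] <-]; exists nu => //; split => //; split => //; exact: mass_probability.
move=> _ [nu [[snu nu1] mF] <-]; exists (prob_of nu1) => //=.
by congr (_ * _)%E; exact: H_ext.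
Qed.

End rate_identification.

Theorem proposition1p5 (R : realType) (Gamma lm lp : R)
    (q : probability (measurableTypeR R) R)
    (hGamma : 0 < Gamma) (hl : lm <= lp)
    (hq : supported_on `[lm, lp] q) :
  [/\ {within `]m_minus lm lp Gamma, m_plus lp Gamma[,
         continuous (I_H q lm lp Gamma)},
      nonincreasing_on `]m_minus lm lp Gamma, m_bar q lp Gamma]
        (I_H q lm lp Gamma),
      convex_on `[m_bar q lp Gamma, m_plus lp Gamma[ (I_H q lm lp Gamma) &
      strictly_increasing_on `[m_bar q lp Gamma, m_plus lp Gamma[
        (I_H q lm lp Gamma)] /\
  [/\ {within `]lp / 2, +oo[, continuous (I_G q lm lp Gamma)},
      nonincreasing_on `]lp / 2, m_bar q lp Gamma] (I_G q lm lp Gamma),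
      convex_on `[m_bar q lp Gamma, +oo[ (I_G q lm lp Gamma) &
      strictly_increasing_on `[m_bar q lp Gamma, +oo[ (I_G q lm lp Gamma)].
Proof.
have supp_convex (mu nu : {finite_measure set (measurableTypeR R) -> \bar R}) s :
    0 <= s <= 1 -> supported_on `[lm, lp] mu -> supported_on `[lm, lp] nu ->
    supported_on `[lm, lp] (lincomb (1 - s) s mu nu).
  move=> /andP[s0 s1] smu snu; rewrite /supported_on /= lincombE ?subr_ge0//.
  by rewrite [X in (_ * X + _)%E]smu [X in (_ + _ * X)%E]snu !mule0 adde0.
have supp_dirac (x : R) : lm <= x <= lp ->
    supported_on `[lm, lp] (dirac (x : measurableTypeR R)).
  move=> xI; rewrite /supported_on /= diracE.
  suff -> : (x \in ~` `[lm, lp]) = false by [].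
  by apply/negbTE; rewrite notin_setE; apply; rewrite /= in_itv.
split.
- rewrite I_H_rate.
  apply: (rate_profile (kappa := dirac (lm : measurableTypeR R))) => //.
  + move=> mu nu s s01 [smu mu1] [snu nu1]; split; first exact: supp_convex.
    by have /andP[s0 s1] := s01; rewrite mass_lincomb ?subr_ge0// mu1 nu1; ring.
  + by split => //; exact: mass_probability.
  + by split; [apply: supp_dirac; rewrite lexx|exact: mass_probability].
  + by rewrite mass_probability.
  + by move=> theta0 T; exact: stieltjes_dirac_cmp.
  + move=> m; rewrite in_itv/= => mm.
    exists (dirac (lp : measurableTypeR R)) => //.
    by split; [apply: supp_dirac; rewrite hl lexx|exact: mass_probability].
- rewrite I_G_rate; apply: (rate_profile (kappa := mzero)) => //.
  + move=> theta0 T lt0; have [r r0 rP] := stieltjes_mzero_cmp T lt0.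
    by exists r => // nu theta _; exact: rP.
  + by rewrite F_mzero.
  + move=> m _; have [C C0 mC] := F_lincomb_dirac_unbounded lp hGamma m.
    exists (lincomb C 0 (dirac (lp : measurableTypeR R)) mzero) => //.
    rewrite /supported_on /= lincombE//.
    rewrite [X in (_ * X + _)%E](supp_dirac lp) ?hl ?lexx//.
    by rewrite mule0 mul0e adde0.
Qed.
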